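(* Let $m\ge 1$ and $p\ge 1$ be integers, let $q_1,\dots,q_m$ be positive integers each coprime to $p$, and let $M=\{1,2,\dots,m\}$. Then for every $k\in\{0,1,\dots,p-1\}$ and every integer $n\ge 0$, $$N_{\mathcal{L}}(k+np)=\sum_{t=0}^{m-1}\ \sum_{U\subseteq M} C_{m-1}^{\,n-t+|U|-1}\,\gamma(U,k+tp).$$
   Context: For $U=\{i_1<\dots<i_u\}\subseteq M$ (possibly empty), the congruence lattice associated to $U$ is $$\mathcal{L}(U)=\{(x_{i_1},\dots,x_{i_u})\in\mathbb{Z}^u : x_{i_1}q_{i_1}+\cdots+x_{i_u}q_{i_u}\equiv 0 \pmod p\},$$ with 1-norm $\|x\|_1=|x_{i_1}|+\cdots+|x_{i_u}|$. For $U=\emptyset$, $\mathcal{L}(\emptyset)$ consists of the empty tuple only, which has 1-norm $0$. For an integer $h\ge 0$ set $$\Omega(U,h)=\{x\in\mathcal{L}(U) : \|x\|_1=h\},\qquad C(U,h)=\{x\in\Omega(U,h) : |x_i|<p \text{ for all } i\in U\},$$ and $\gamma(U,h)=|C(U,h)|$, $N_{\mathcal{L}}(h)=|\Omega(M,h)|$. For integers $a,b$ with $b\ge 0$, $C_b^a$ denotes the binomial coefficient ''$a$ choose $b$'', equal to $\frac{a!}{b!(a-b)!}$ if $a\ge b$ and, by convention, equal to $0$ whenever $a<b$ (including when $a$ is negative). *)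

(* Defs.v *)
From mathcomp Require Import all_boot all_order all_algebra.
From mathcomp Require Import finmap.
From mathcomp Require Import boolp classical_sets functions cardinality.

Set Implicit Arguments.
Unset Strict Implicit.
Unset Printing Implicit Defensive.

Import Order.TTheory GRing.Theory Num.Theory.

Local Open Scope classical_set_scope.
Local Open Scope nat_scope.

(* Elements of Z^u with coordinates labelled by the elements of U rather than
   by their ranks; for U = set0 the type has exactly one element. The index set
   M is 'I_m, that is, indices are shifted from {1, .., m} to {0, .., m - 1}. *)
Notation zvec U := {ffun {i | i \in U} -> int}.

Definition norm1 (m : nat) (U : {set 'I_m}) (x : zvec U) : nat :=
  \sum_i `|x i|%N.

Definition congr_lattice (m p : nat) (q : 'I_m -> nat) (U : {set 'I_m}) :
    set (zvec U) :=
  [set x : zvec U | ((\sum_i x i * (q (val i))%:Z)%R = 0 %[mod p%:Z])%Z].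

Definition Omega (m p : nat) (q : 'I_m -> nat) (U : {set 'I_m}) (h : nat) :
    set (zvec U) :=
  [set x | congr_lattice p q x /\ norm1 x = h].

Definition Cset (m p : nat) (q : 'I_m -> nat) (U : {set 'I_m}) (h : nat) :
    set (zvec U) :=
  [set x | Omega p q h x /\ forall i, `|x i|%N < p].

(* fset_set sends infinite sets to fset0; by the next two lemmas it is only
   used below on finite sets. *)
Lemma finite_Omega (m p : nat) (q : 'I_m -> nat) (U : {set 'I_m}) (h : nat) :
  finite_set (@Omega m p q U h).
Proof.
pose f (g : {ffun {i | i \in U} -> 'I_(h + h).+1}) : zvec U :=
  [ffun i => ((g i : nat)%:Z - h%:Z)%R].
apply: (@sub_finite_set _ _ (range f)); last first.
  by apply: finite_image; apply: finite_finset.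
move=> x [_ xh].
have le_xh i : `|x i|%N <= h by rewrite -xh /norm1 (bigD1 i) //= leq_addr.
have xh_ge0 i : (0 <= x i + h%:Z)%R.
  by rewrite -lerBlDr sub0r lerNl (le_trans (ler_norm _)) // normrN -abszE lez_nat.
have xh_le i : (x i + h%:Z <= (h + h)%:Z)%R.
  by rewrite PoszD lerD2r (le_trans (ler_norm _)) // -abszE lez_nat.
exists [ffun i => inord (absz (x i + h%:Z)%R)] => //.
apply/ffunP => i; rewrite !ffunE inordK; first by rewrite gez0_abs // addrK.
by rewrite ltnS -lez_nat gez0_abs.
Qed.

Lemma finite_Cset (m p : nat) (q : 'I_m -> nat) (U : {set 'I_m}) (h : nat) :
  finite_set (@Cset m p q U h).
Proof. by apply: sub_finite_set (finite_Omega p q U h) => x []. Qed.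

Definition gamma (m p : nat) (q : 'I_m -> nat) (U : {set 'I_m}) (h : nat) : nat :=
  #|` fset_set (@Cset m p q U h)|%fset.

Definition N_L (m p : nat) (q : 'I_m -> nat) (h : nat) : nat :=
  #|` fset_set (@Omega m p q [set: 'I_m]%SET h)|%fset.

(* 'C(n, b) already vanishes for n < b. *)
Definition binz (a : int) (b : nat) : nat :=
  if a is Posz n then 'C(n, b) else 0.

(* Main.v *)
(** Reduce every coordinate of [x] modulo [p] towards [0], keeping its sign: a
    coordinate [x_i] is then determined by its remainder [y_i], [|y_i| < p], and
    by the quotient of [|x_i|] by [p], except that the sign is lost when [x_i]
    is a nonzero multiple of [p]. Let [U] be the set of the indices [i] for
    which [x_i] is not a negative multiple of [p], and decrease the quotient by
    one outside [U], where it is positive. This turns [x] into [U], a point [y]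
    of the lattice of [U] with all [|y_i| < p], and an arbitrary vector [c] of
    [m] naturals, with [|x| = |y| + p (|c| + m - |U|)]. If
    [|x| = k + n p], then [|y| = k + t p] with [t < m], and [c] is a
    composition of [n - t + |U| - m] into [m] parts, for which there are
    [C(n - t + |U| - 1, m - 1)] choices. *)
Require Import Defs.
From mathcomp Require Import all_boot all_order all_algebra.
From mathcomp Require Import finmap classical_sets cardinality boolp.
From mathcomp Require Import zify.

Set Implicit Arguments.
Unset Strict Implicit.
Unset Printing Implicit Defensive.

Import Order.TTheory GRing.Theory Num.Theory.

Local Open Scope nat_scope.

(** * Extension of lattice vectors by zero to all indices *)

Section ExtensionByZero.

Variables (m : nat) (U : {set 'I_m}).

(** Indexing every vector by ['I_m] makes norms and congruences for different [U] sums over one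
    index type. *)
Definition zext (y : zvec U) (i : 'I_m) : int := oapp y 0%R (insub i).

Definition zres (g : 'I_m -> int) : zvec U := [ffun i => g (val i)].

Lemma zext_val (y : zvec U) i : zext y (val i) = y i.
Proof. by rewrite /zext valK. Qed.

Lemma zext_out (y : zvec U) i : i \notin U -> zext y i = 0%R.
Proof. by move=> iU; rewrite /zext insubN. Qed.

Lemma zext_res g i : i \in U -> zext (zres g) i = g i.
Proof. by move=> iU; rewrite -[i]/(val (exist _ i iU)) zext_val ffunE. Qed.

Lemma zres_ext y : zres (zext y) = y.
Proof. by apply/ffunP => i; rewrite ffunE zext_val. Qed.

Lemma norm1_zext (y : zvec U) : norm1 y = \sum_i `|zext y i|.
Proof.
rewrite (bigID (mem U)) /= [X in _ + X]big1 ?addn0.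
  by rewrite big_sub; apply: eq_bigr => i _; rewrite zext_val.
by move=> i iU; rewrite zext_out.
Qed.

Lemma congr_lattice_zext p (q : 'I_m -> nat) (y : zvec U) :
  congr_lattice p q y <->
  ((\sum_i zext y i * (q i)%:Z)%R = 0 %[mod p%:Z])%Z.
Proof.
rewrite [in X in _ <-> X](bigID (mem U)) /= [X in (_ + X)%R]big1 ?addr0.
  rewrite big_sub /congr_lattice /=.
  by under [X in _ <-> (X = _ %[mod _])%Z]eq_bigr do rewrite zext_val.
by move=> i iU; rewrite zext_out ?mul0r.
Qed.

End ExtensionByZero.

(** * Splitting one integer into a sign class, a remainder and a quotient *)

Section Coordinate.

Variable p : nat.
Hypothesis p_gt0 : 0 < p.

Definition negmul (x : int) : bool := (x < 0)%R && (p %| `|x|).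

Definition trunc (x : int) : int :=
  if (x < 0)%R then (- (`|x| %% p)%N%:Z)%R else (`|x| %% p)%N%:Z%R.

(* The subtraction is never truncated: a negative multiple of [p] has quotient
   at least [1]. *)
Definition level (x : int) : nat := `|x| %/ p - negmul x.

(** Inverse of the splitting. For [b] false, [y] is ignored and [c.+1] undoes the decrement in
    [level]; for [b] true, a zero [y] gives the nonnegative multiple [c * p]. *)
Definition glue (b : bool) (y : int) (c : nat) : int :=
  if b then if (y < 0)%R then (y - (c * p)%N%:Z)%R else (y + (c * p)%N%:Z)%R
  else (- (c.+1 * p)%N%:Z)%R.

Lemma abs_trunc x : `|trunc x| = `|x| %% p.
Proof. by rewrite /trunc; case: ifP => _; rewrite ?abszN. Qed.

Lemma abs_trunc_lt x : `|trunc x| < p.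
Proof. by rewrite abs_trunc ltn_pmod. Qed.

Lemma trunc_negmul x : negmul x -> trunc x = 0%R.
Proof.
by case/andP=> _; rewrite /dvdn => /eqP xp; rewrite /trunc xp; case: ifP.
Qed.

Lemma abs_glue b y c : (~~ b -> y = 0%R) ->
  `|glue b y c| = `|y| + (c + ~~ b) * p.
Proof.
rewrite /glue; case: b => [_|/(_ isT) ->]; last by rewrite addn1; lia.
by rewrite addn0; case: ifP; lia.
Qed.

Lemma glue_mod b y c : (~~ b -> y = 0%R) -> (glue b y c = y %[mod p%:Z])%Z.
Proof.
move=> by0; apply/eqP; rewrite eqz_mod_dvd /glue.
case: b by0 => [_|/(_ isT) ->].
  by case: ifP => _; rewrite addrAC subrr add0r dvdzE ?abszN dvdn_mull.
by rewrite subr0 dvdzE abszN dvdn_mull.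
Qed.

Lemma negmul_glue b y c : `|y| < p -> negmul (glue b y c) = ~~ b.
Proof.
rewrite /negmul /glue => yp; case: b => /=; last first.
  by rewrite abszN dvdn_mull // andbT; nia.
case: (ltP y 0%R) => y0 /=; last by rewrite ltNge (_ : (0 <= _)%R) //; nia.
have -> : `|(y - (c * p)%N%:Z)%R| = c * p + `|y| by lia.
by rewrite dvdn_addr ?dvdn_mull // gtnNdvd ?andbF //; lia.
Qed.

Lemma level_glue b y c : `|y| < p -> (~~ b -> y = 0%R) ->
  level (glue b y c) = c.
Proof.
move=> yp by0; rewrite /level negmul_glue // abs_glue // addnC divnMDl //.
by rewrite divn_small //; lia.
Qed.

Lemma trunc_glue y c : `|y| < p -> trunc (glue true y c) = y.
Proof.
move=> yp; rewrite /trunc abs_glue // addn0 addnC modnMDl modn_small //.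
by rewrite /glue; case: ifP; case: ifP; lia.
Qed.

Lemma glueK x : glue (~~ negmul x) (trunc x) (level x) = x.
Proof.
rewrite /level; case: (boolP (negmul x)) => xn; rewrite /glue /=.
  have /andP[x0 px] := xn; have := divnK px; case: (_ %/ _) => [|n]; lia.
have := divn_eq `|x| p; rewrite subn0 => xE.
move: xn; rewrite /negmul /trunc /dvdn; case: (ltP x 0%R) => /= x0 xn; last by lia.
(* Here [x] is negative and not a multiple of [p], so its remainder is nonzero and the truncation
   keeps the sign. *)
by rewrite ifT; lia.
Qed.

End Coordinate.

(** * The correspondence between vectors and triples of [U], [y] and [c] *)

Section Decomposition.

Variables (m p : nat) (q : 'I_m -> nat).
Hypothesis p_gt0 : 0 < p.

Definition negset (x : zvec [set: 'I_m]) : {set 'I_m} :=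
  [set i | ~~ negmul p (zext x i)].

(** [U] is a free argument, to be [negset x] in use, so that the type does not depend on [x]. *)
Definition truncv (U : {set 'I_m}) (x : zvec [set: 'I_m]) : zvec U :=
  zres U (fun i => trunc p (zext x i)).

Definition height (x : zvec [set: 'I_m]) : nat :=
  norm1 (truncv (negset x) x) %/ p.

Definition assemble (U : {set 'I_m}) (y : zvec U) (c : 'I_m -> nat) :
    zvec [set: 'I_m] :=
  zres [set: 'I_m] (fun i => glue p (i \in U) (zext y i) (c i)).

Lemma zext_assemble (U : {set 'I_m}) (y : zvec U) c i :
  zext (assemble y c) i = glue p (i \in U) (zext y i) (c i).
Proof. by rewrite zext_res ?inE. Qed.

Lemma norm1_assemble (U : {set 'I_m}) (y : zvec U) c :
  norm1 (assemble y c) = norm1 y + (\sum_i c i + (m - #|U|)) * p.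
Proof.
rewrite !norm1_zext.
rewrite (eq_bigr (fun i => `|zext y i| + (c i + (i \notin U)) * p)); last first.
  by move=> i _; rewrite zext_assemble abs_glue //; apply: zext_out.
rewrite big_split -big_distrl big_split /=; congr (_ + (_ + _) * _).
rewrite -[m in m - _]card_ord -(cardsC U) addKn -sum1_card [RHS]big_mkcond /=.
by apply: eq_bigr => i _; rewrite inE; case: (i \in U).
Qed.

(** Each coordinate moves by a multiple of [p], starting from zero outside [U]. *)
Lemma congr_assemble (U : {set 'I_m}) (y : zvec U) c :
  congr_lattice p q (assemble y c) <-> congr_lattice p q y.
Proof.
rewrite !congr_lattice_zext.
suff -> : ((\sum_i zext (assemble y c) i * (q i)%:Z)%R =
           (\sum_i zext y i * (q i)%:Z)%R %[mod p%:Z])%Z by [].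
elim/big_ind2: _ => // [a b a' b' abE abE'|i _].
  by rewrite -modzDm abE abE' modzDm.
by rewrite zext_assemble -modzMml glue_mod ?modzMml //; apply: zext_out.
Qed.

Section Bounded.

Variables (U : {set 'I_m}) (y : zvec U).
Hypothesis y_lt : forall i, `|y i| < p.

Lemma zext_lt i : `|zext y i| < p.
Proof.
have [iU|iU] := boolP (i \in U); last by rewrite zext_out.
by rewrite -[i]/(val (exist _ i iU)) zext_val.
Qed.

Lemma negset_assemble c : negset (assemble y c) = U.
Proof.
by apply/setP => i; rewrite inE zext_assemble negmul_glue ?negbK ?zext_lt.
Qed.

Lemma truncv_assemble c : truncv U (assemble y c) = y.
Proof.
apply/ffunP => i; rewrite ffunE zext_assemble (valP i).
by rewrite trunc_glue ?zext_lt ?zext_val.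
Qed.

Lemma level_assemble c i : level p (zext (assemble y c) i) = c i.
Proof. by rewrite zext_assemble level_glue ?zext_lt //; apply: zext_out. Qed.

Lemma height_assemble c : height (assemble y c) = norm1 y %/ p.
Proof. by rewrite /height negset_assemble truncv_assemble. Qed.

End Bounded.

Lemma truncv_lt U x i : `|truncv U x i| < p.
Proof. by rewrite ffunE abs_trunc_lt. Qed.

Lemma assembleK x :
  assemble (truncv (negset x) x) (fun i => level p (zext x i)) = x.
Proof.
rewrite -[RHS]zres_ext; congr zres; apply/funext => i.
rewrite -[RHS](glueK p_gt0) inE; case: (boolP (negmul p _)) => xi //=.
by rewrite zext_res ?inE.
Qed.

Lemma norm1_truncv U x : norm1 (truncv U x) <= m * p.-1.
Proof.
rewrite norm1_zext -[m in m * _]card_ord -sum_nat_const leq_sum // => i _.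
by rewrite -ltnS prednK // zext_lt //; apply: truncv_lt.
Qed.

End Decomposition.

(** * Counting the vectors with given [U] and [t] *)

Section Counting.

Variables (m' p : nat) (q : 'I_m'.+1 -> nat).
Hypothesis p_gt0 : 0 < p.
Local Notation m := m'.+1.

(** Stars and bars: [n - (t + (m - #|U|))] is the total left to the [m] quotients. *)
Lemma binz_complement (U : {set 'I_m}) n t : t + (m - #|U|) <= n ->
  binz (n%:Z - t%:Z + #|U|%:Z - 1)%R m' = 'C(m' + (n - (t + (m - #|U|))), m').
Proof.
move=> tn; have Um : #|U| <= m by rewrite (leq_trans (max_card _)) ?card_ord.
have -> // : (n%:Z - t%:Z + #|U|%:Z - 1)%R
  = (m' + (n - (t + (m - #|U|))))%N%:Z%R by lia.
Qed.

(** The quotients would need a negative total; the upper argument is then negative or a natural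
    below [m']. *)
Lemma binz_small (U : {set 'I_m}) n t : n < t + (m - #|U|) ->
  binz (n%:Z - t%:Z + #|U|%:Z - 1)%R m' = 0.
Proof.
move=> nt; have Um : #|U| <= m by rewrite (leq_trans (max_card _)) ?card_ord.
case E : (n%:Z - t%:Z + #|U|%:Z - 1)%R => [a|a] //=.
by rewrite bin_small //; lia.
Qed.

(** Truncation lowers the norm by a multiple of [p], so the residue [k] survives. *)
Lemma height_eq k n (x : zvec [set: 'I_m]) : k < p -> norm1 x = k + n * p ->
  norm1 (truncv p (negset p x) x) = k + height p x * p.
Proof.
move=> kp; rewrite -[in norm1 x](assembleK p_gt0 x) norm1_assemble //.
rewrite /height => /(congr1 (modn^~ p)) /=.
rewrite addnC modnMDl addnC modnMDl (modn_small kp) => <-.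
by rewrite addnC -divn_eq.
Qed.

(** The truncated norm is at most [m * p.-1], which is below [m * p]; this bounds the outer sum. *)
Lemma height_lt (x : zvec [set: 'I_m]) : height p x < m.
Proof.
rewrite ltn_divLR // (leq_ltn_trans (norm1_truncv p_gt0 _ _)) //.
by rewrite ltn_pmul2l // prednK.
Qed.

Lemma card_stratum (U : {set 'I_m}) (k n t : nat) : k < p ->
  count (fun x => (height p x == t) && (negset p x == U))
    (fset_set (Omega p q (U := [set: 'I_m]) (k + n * p))) =
  binz (n%:Z - t%:Z + #|U|%:Z - 1)%R m' * gamma p q U (k + t * p).
Proof.
move=> kp; rewrite -size_filter.
set s := filter _ _.
have mem_s x : reflect
    [/\ congr_lattice p q x, norm1 x = k + n * p, height p x = t & negset p x = U]
    (x \in s).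
  rewrite mem_filter (in_fset_set (finite_Omega _ _ _ _)).
  apply: (iffP idP) => [/andP[/andP[/eqP ? /eqP ?]]|].
    by rewrite inE => -[].
  by case=> Lx xE -> ->; rewrite !eqxx /=; apply/mem_set; split.
have norm_s x : x \in s ->
    n = t + \sum_i level p (zext x i) + (m - #|U|).
  case/mem_s => _ xE xt xU; have := xE.
  rewrite -[in norm1 x](assembleK p_gt0 x) norm1_assemble //.
  rewrite (height_eq kp xE) xt xU -addnA -mulnDl => /addnI/eqP.
  by rewrite eqn_pmul2r // addnA => /eqP.
have [nt|nt] := ltnP n (t + (m - #|U|)).
  (* The stratum is empty, since by [norm_s] any member forces the opposite inequality. *)
  rewrite binz_small // mul0n; case: (s) norm_s => // x l /(_ x (mem_head _ _)).
  by move=> nE; move: nt; rewrite nE addnAC ltnNge leq_addr.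
rewrite binz_complement // mulnC; set j := n - _.
(* Naturals with sum [j] are each at most [j], so tuples over ['I_j.+1] give every [c]. *)
rewrite -card_ord_partitions /gamma; set T := finset _; set C := fset_set _.
have mem_C y : reflect (Cset p q (k + t * p) y) (y \in C).
  rewrite (in_fset_set (finite_Cset _ _ _ _)).
  by apply: (iffP idP) => [/set_mem|/mem_set].
pose dec (y : zvec U) (c : m.-tuple 'I_j.+1) := assemble p y (tnth c).
rewrite [#|T|]cardE -(size_allpairs dec); apply: perm_size; apply: uniq_perm.
- exact/filter_uniq/fset_uniq.
- apply: allpairs_uniq; [exact: fset_uniq|exact: enum_uniq|].
  move=> [y c] [z d] /allpairsP[[? ?] /= [/mem_C[_ ylt] _ [yE _]]].
  move=> /allpairsP[[? ?] /= [/mem_C[_ zlt] _ [zE _]]] /= yzE.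
  rewrite -{}yE in ylt; rewrite -{}zE in zlt.
  (* Injectivity: truncation recovers [y], and the levels recover [c]. *)
  have := congr1 (truncv p U) yzE; rewrite /dec !truncv_assemble // => ->.
  congr pair; apply: eq_from_tnth => i; apply: val_inj => /=.
  have := congr1 (fun x => level p (zext x i)) yzE.
  by rewrite /dec !level_assemble.
move=> x; apply/idP/allpairsP => [xs|[[y c] /= [yC cT ->]]].
  have [Lx xE xt xU] := mem_s _ xs; have nE := norm_s _ xs.
  have lev_sum : \sum_i level p (zext x i) = j by rewrite /j nE addnAC addKn.
  have lev_lt i : level p (zext x i) < j.+1.
    by rewrite ltnS -lev_sum (bigD1 i) //= leq_addr.
  exists (truncv p U x, [tuple Ordinal (lev_lt i) | i < m]); split => /=.
  + apply/mem_C; split; last exact: truncv_lt.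
    split; last by rewrite -xU (height_eq kp xE) xt.
    apply/(congr_assemble p q _ (fun i => level p (zext x i))).
    by rewrite -xU assembleK.
  + rewrite mem_enum inE big_tuple -[X in _ == X]lev_sum; apply/eqP.
    by apply: eq_bigr => i _; rewrite tnth_mktuple.
  rewrite -[LHS](assembleK p_gt0) xU; congr zres; apply/funext => i.
  by rewrite tnth_mktuple.
have [[Ly yE] ylt] := mem_C _ yC.
apply/mem_s; split.
- exact/congr_assemble.
- rewrite norm1_assemble // yE.
  move: cT; rewrite mem_enum inE big_tuple => /eqP ->; rewrite /j.
  by rewrite -addnA -mulnDl addnCA subnK.
- by rewrite height_assemble // yE addnC divnMDl // divn_small ?addn0.
- by rewrite negset_assemble.
Qed.

End Counting.

Theorem theorem3p2 (m p : nat) (q : 'I_m -> nat)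
  (hm : 1 <= m) (hp : 1 <= p)
  (hq : forall i, 0 < q i) (hqp : forall i, coprime (q i) p)
  (k n : nat) (hk : k < p) :
  N_L p q (k + n * p) =
    \sum_(t < m) \sum_(U : {set 'I_m})
      binz (n%:Z - t%:Z + #|U|%:Z - 1)%R (m - 1) * gamma p q U (k + t * p).
Proof.
case: m hm q hq hqp => // m' _ q _ _.
rewrite subn1 /= /N_L card_fset_sum1 pair_big /=.
rewrite (partition_big (fun x => (Ordinal (height_lt hp x), negset p x)) predT) //=.
apply: eq_bigr => -[t U] _ /=.
by rewrite sum1_count -card_stratum.
Qed.
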